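(* Let $x$ be a real. If there exists a $\Sigma^1_2(x)$ inextendible linearly ordered tower, then there exists a $\Pi^1_1(x)$ inextendible linearly ordered tower.
   Context: For $x,y\in[\omega]^\omega$ (or infinite subsets of $\omega\times\omega$), $y\subseteq^* x$ means $y\setminus x$ is finite. An inextendible linearly ordered tower (ilt) is a family of infinite subsets of a countable set, linearly ordered by $\subseteq^*$, with no infinite $z$ such that $z\subseteq^* x$ for all members $x$. *)

(* Defs.v *)
From mathcomp Require Import all_boot.
From mathcomp Require Import boolp classical_sets functions cardinality.

Set Implicit Arguments.
Unset Strict Implicit.
Unset Printing Implicit Defensive.

Local Open Scope classical_set_scope.

Definition almost_subset (T : Type) (y x : set T) : Prop :=
  finite_set (y `\` x).

(* [almost_subset] is only a preorder on sets: being linearly ordered means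
   that any two members are comparable, and members that differ by a finite
   set are not identified. *)
Definition ilt (T : countType) (F : set (set T)) : Prop :=
  [/\ forall x, F x -> infinite_set x,
      forall x y, F x -> F y -> almost_subset x y \/ almost_subset y x
    & ~ exists z : set T,
          infinite_set z /\ forall x, F x -> almost_subset z x].

(* The language of second-order arithmetic, with one sort for natural numbers
   and one for functions nat -> nat. Variables of both sorts are de Bruijn
   indices, counted separately. *)
Inductive term : Type :=
  | TVar of nat
  | TZero
  | TSucc of term
  | TAdd of term & term
  | TMul of term & term
  | TApp of nat & term. (* function variable applied to a term *)

Inductive formula : Type :=
  | FEq of term & term
  | FLt of term & term
  | FNot of formula
  | FAnd of formula & formula
  | FOr of formula & formula
  | FAll0 of formula
  | FEx0 of formula
  | FAll1 of formula
  | FEx1 of formula.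

Definition scons (T : Type) (a : T) (e : nat -> T) (i : nat) : T :=
  if i is j.+1 then e j else a.

Fixpoint eval (e0 : nat -> nat) (e1 : nat -> nat -> nat) (t : term) : nat :=
  match t with
  | TVar i => e0 i
  | TZero => 0
  | TSucc t => (eval e0 e1 t).+1
  | TAdd t u => eval e0 e1 t + eval e0 e1 u
  | TMul t u => eval e0 e1 t * eval e0 e1 u
  | TApp i t => e1 i (eval e0 e1 t)
  end.

Fixpoint sat (e0 : nat -> nat) (e1 : nat -> nat -> nat) (p : formula) : Prop :=
  match p with
  | FEq t u => eval e0 e1 t = eval e0 e1 u
  | FLt t u => eval e0 e1 t < eval e0 e1 u
  | FNot p => ~ sat e0 e1 p
  | FAnd p q => sat e0 e1 p /\ sat e0 e1 q
  | FOr p q => sat e0 e1 p \/ sat e0 e1 q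
  | FAll0 p => forall n : nat, sat (scons n e0) e1 p
  | FEx0 p => exists n : nat, sat (scons n e0) e1 p
  | FAll1 p => forall f : nat -> nat, sat e0 (scons f e1) p
  | FEx1 p => exists f : nat -> nat, sat e0 (scons f e1) p
  end.

Fixpoint arithmetical (p : formula) : bool :=
  match p with
  | FEq _ _ | FLt _ _ => true
  | FNot p | FAll0 p | FEx0 p => arithmetical p
  | FAnd p q | FOr p q => arithmetical p && arithmetical q
  | FAll1 _ | FEx1 _ => false
  end.

Fixpoint Sigma1_formula (n : nat) (p : formula) : bool :=
  match n, p with
  | 0, _ => arithmetical p
  | m.+1, FEx1 q => Pi1_formula m q
  | _, _ => false
  end
with Pi1_formula (n : nat) (p : formula) : bool :=
  match n, p with
  | 0, _ => arithmetical p
  | m.+1, FAll1 q => Sigma1_formula m q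
  | _, _ => false
  end.

(* A subset of omega is identified with its characteristic function, which
   interprets function variable 0; the real parameter x interprets function
   variable 1. The remaining free variables are interpreted by 0 and so carry
   no information. *)
Definition defined_set (x : nat -> nat) (p : formula) : set (set nat) :=
  [set a : set nat |
    sat (fun=> 0)
        (scons (fun n => nat_of_bool (n \in a)) (scons x (fun _ _ => 0))) p].

Definition Sigma1 (n : nat) (x : nat -> nat) (F : set (set nat)) : Prop :=
  exists2 p : formula, Sigma1_formula n p & F = defined_set x p.

Definition Pi1 (n : nat) (x : nat -> nat) (F : set (set nat)) : Prop :=
  exists2 p : formula, Pi1_formula n p & F = defined_set x p.

(* Main.v *)
(* Let F be the given tower, y in F iff R(y, w) for some w, with R of class
   Pi11. Code a pair (y, w) by the planar set z whose columns over points
   outside y are empty, and whose column over the k-th point of y has height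
   H k, where H 0 = 1, H (k+1) is 2 H k or 2 H k + 1, and the digits of H encode
   w. If y' minus y is infinite and y is almost contained in y', then almost
   every point of y has a larger index in y' than in y, and H k < 2^(k+1) <=
   H' (k+1) makes the code of (y, w) almost contained in that of (y', w'),
   whatever w and w' are; if y and y' are almost equal, then the heights compare
   lexicographically. Hence all codes of all pairs in R are linearly ordered, and
   no uniformization of R is needed. Columns are finite, so a pseudointersection
   of the codes projects to one of F. Finally y, H and w are arithmetically
   determined by z, so "some (y, w) coded by z is in R" can be rewritten with a
   universal quantifier and is Pi11. *)
Require Import Defs.
From mathcomp Require Import all_boot.
From mathcomp Require Import boolp classical_sets functions cardinality.
From mathcomp Require Import zify.

Set Implicit Arguments.
Unset Strict Implicit.
Unset Printing Implicit Defensive.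

Local Open Scope classical_set_scope.

(** * Finiteness and almost inclusion on the naturals, as eventual statements *)

Lemma finite_set_natP (A : set nat) :
  finite_set A <-> exists N, forall n, A n -> n < N.
Proof.
split=> [/finite_seqP[s ->]|[N AN]].
  exists (\max_(i <- s) i).+1 => n /= ns.
  by rewrite ltnS (big_rem n) //= leq_maxl.
apply: (sub_finite_set _ (finite_II N)) => n /AN.
by rewrite /mkset.
Qed.

Lemma infinite_set_natP (A : set nat) :
  infinite_set A <-> forall N, exists2 n, N <= n & A n.
Proof.
split=> [infA N|infA /finite_set_natP[N AN]].
  apply: contrapT => nA; apply: infA; apply/finite_set_natP; exists N => n An.
  by rewrite ltnNge; apply/negP => Nn; apply: nA; exists n.
by have [n Nn /AN] := infA N; rewrite ltnNge Nn.
Qed.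

Lemma almost_subset_natP (A B : set nat) :
  almost_subset A B <-> exists N, forall n, N <= n -> A n -> B n.
Proof.
split=> [/finite_set_natP[N AN]|[N AN]].
  exists N => n Nn An; apply: contrapT => Bn.
  by have := AN n (conj An Bn); rewrite ltnNge Nn.
apply/finite_set_natP; exists N => n [An Bn].
by rewrite ltnNge; apply/negP => Nn; apply/Bn/AN.
Qed.

(** * Pairing, and ranks of points in a set *)

Definition qpair (n m : nat) : nat := (n + m) * (n + m) + n.

(** Pairs with sum [s] land between [s * s] and [s * s + s], and these intervals are disjoint. The
    pairing is a polynomial, hence expressible by a term, but it is not onto. *)
Lemma qpair_inj n m n' m' : qpair n m = qpair n' m' -> n = n' /\ m = m'.
Proof.
have lt a b a' b' : a + b < a' + b' -> qpair a b < qpair a' b'.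
  by rewrite /qpair; nia.
case: (ltngtP (n + m) (n' + m')) => [/lt|/lt|]; [lia|lia|].
by move=> e; rewrite /qpair e; lia.
Qed.

Lemma qpair_gel n m : n <= qpair n m.
Proof. exact: leq_addl. Qed.

Definition rank (y : set nat) (n : nat) : nat := 
  \sum_(0 <= i < n) (i \in y).

Lemma rank0 y : rank y 0 = 0.
Proof. by rewrite /rank big_geq. Qed.

Lemma rankS y n : rank y n.+1 = rank y n + (n \in y).
Proof. by rewrite /rank big_nat_recr. Qed.

Lemma leq_rank y m n : m <= n -> rank y m <= rank y n.
Proof.
by apply: (homo_leq _ leq_trans) => // i; rewrite rankS leq_addr.
Qed.

Lemma rank_inj (y : set nat) n n' : y n -> y n' -> rank y n = rank y n' -> n = n'.
Proof.
have lt_rank i j : y i -> i < j -> rank y i < rank y j.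
  move=> /mem_set yi ij; apply: leq_trans (leq_rank y ij).
  by rewrite rankS yi addn1.
move=> yn yn' e; case: (ltngtP n n') => // lt.
  by have := lt_rank _ _ yn lt; rewrite e ltnn.
by have := lt_rank _ _ yn' lt; rewrite e ltnn.
Qed.

Lemma rank_unbounded (y : set nat) k : infinite_set y -> exists n, k <= rank y n.
Proof.
move=> /infinite_set_natP yinf; elim: k => [|k [n kn]]; first by exists 0.
have [m nm ym] := yinf n; exists m.+1.
rewrite rankS (mem_set ym) addn1 ltnS.
exact: leq_trans kn (leq_rank _ nm).
Qed.

Lemma rank_surj (y : set nat) k : infinite_set y -> exists2 n, y n & rank y n = k.
Proof.
(* The least number of rank above [k] is a successor, and its predecessor is the required point. *)
move=> yinf; have [[|n] kn nmin] := ex_minnP (rank_unbounded k.+1 yinf).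
  by rewrite rank0 in kn.
have nk : rank y n <= k by rewrite leqNgt; apply/negP => /nmin; rewrite ltnn.
move: kn; rewrite rankS; case: (boolP (n \in y)) => [|_]; last by lia.
by move=> /set_mem yn kn; exists n => //; lia.
Qed.

(** * Height functions that grow by one binary digit per step *)

Definition doubling (H : nat -> nat) : Prop :=
  H 0 = 1 /\ forall k, H k.+1 = H k + H k \/ H k.+1 = (H k + H k).+1.

(** In binary, [H k] is a leading 1 followed by [k] further digits. *)
Lemma doubling_bounds H k : doubling H -> 2 ^ k <= H k < 2 ^ k.+1.
Proof.
move=> [H0 HS]; elim: k => [|k]; first by rewrite H0.
by rewrite !expnS; case: (HS k) => ->; lia.
Qed.

Lemma doubling_lt H H' j k : doubling H -> doubling H' -> j < k -> H j <= H' k.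
Proof.
move=> /(doubling_bounds j)/andP[_ Hj] /(doubling_bounds k)/andP[Hk _] jk.
apply: leq_trans Hk; apply: leq_trans (ltnW Hj) _.
by rewrite leq_exp2l.
Qed.

Lemma leq_doubling H j k : doubling H -> j <= k -> H j <= H k.
Proof.
move=> dH; rewrite leq_eqVlt => /orP[/eqP->//|].
exact: doubling_lt.
Qed.

(** A strict inequality at one index persists, since [a < b] gives [2 * a + 1 < 2 * b]; if [H] is
    never strictly below [H'], the reverse inequality holds everywhere. *)
Lemma doubling_total H H' : doubling H -> doubling H' ->
  (exists K, forall k, K <= k -> H k <= H' k) \/
  (exists K, forall k, K <= k -> H' k <= H k).
Proof.
have stays (A B : nat -> nat) K : doubling A -> doubling B -> A K < B K ->
    forall k, K <= k -> A k <= B k.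
  move=> [_ SA] [_ SB] lt k Kk; apply: ltnW; rewrite -(subnK Kk).
  elim: (k - K) => // i; rewrite addSn => IH.
  by case: (SA (i + K)); case: (SB (i + K)); lia.
move=> dH dH'.
have [[K lt]|nlt] := pselect (exists K, H K < H' K).
  by left; exists K; apply: stays.
right; exists 0 => k _; rewrite leqNgt; apply/negP => lt.
by apply: nlt; exists k.
Qed.

(** * Staircases and their comparison under almost inclusion *)

Definition staircase (y : set nat) (H : nat -> nat) : set nat :=
  [set i | exists n m, [/\ i = qpair n m, y n & m < H (rank y n)]].

Lemma staircaseE y H n m : staircase y H (qpair n m) <-> y n /\ m < H (rank y n).
Proof.
split=> [[n' [m' [/qpair_inj[-> ->] ? ?]]]//|[yn lt]].
by exists n, m.
Qed.

Lemma staircase0 (y : set nat) H n : doubling H -> staircase y H (qpair n 0) <-> y n.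
Proof.
move=> dH; rewrite staircaseE; split=> [[]//|yn]; split=> //.
have /andP[+ _] := doubling_bounds (rank y n) dH.
by apply: leq_trans; rewrite expn_gt0.
Qed.

Lemma infinite_staircase y H :
  doubling H -> infinite_set y -> infinite_set (staircase y H).
Proof.
move=> dH /infinite_set_natP yinf; apply/infinite_set_natP => N.
have [n Nn yn] := yinf N; exists (qpair n 0).
  exact: leq_trans Nn (qpair_gel _ _).
exact/staircase0.
Qed.

(* The columns of a staircase are finite, so finitely many of them are
   negligible. *)
Lemma staircase_column_bound (y : set nat) H N n m : doubling H -> n < N ->
  staircase y H (qpair n m) -> qpair n m < qpair N (H (rank y N)).
Proof.
move=> dH nN /staircaseE[_ lt].
have le : m <= H (rank y N).
  apply: leq_trans (ltnW lt) _; apply: leq_doubling dH _; apply: leq_rank.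
  exact: ltnW.
by move: nN le; rewrite /qpair; nia.
Qed.

Lemma staircase_almost_subset (y y' : set nat) H H' N : doubling H ->
  (forall n, N <= n -> y n -> y' n /\ H (rank y n) <= H' (rank y' n)) ->
  almost_subset (staircase y H) (staircase y' H').
Proof.
move=> dH le; apply/almost_subset_natP; exists (qpair N (H (rank y N))) => i.
move=> iN zi; have [n [m [ei yn lt]]] := zi.
have [nN|Nn] := ltnP n N.
  by move: iN; rewrite ei leqNgt (staircase_column_bound dH nN) // -ei.
have [yn' leH] := le _ Nn yn.
by rewrite ei; apply/staircaseE; split => //; apply: leq_trans leH.
Qed.

(** The lead of [y'] in rank at [N] is never lost, because every later point of [y] is also one of
    [y']; a larger index then outweighs any choice of digits. *)
Lemma staircase_rank_lt (y y' : set nat) H H' N : doubling H -> doubling H' ->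
  (forall n, N <= n -> y n -> y' n) -> rank y N < rank y' N ->
  almost_subset (staircase y H) (staircase y' H').
Proof.
move=> dH dH' sub lt; apply: (@staircase_almost_subset _ _ _ _ N) => // n Nn yn.
split; first exact: sub.
apply: doubling_lt => //; rewrite -(subnK Nn).
elim: (n - N) => // i IH; rewrite addSn !rankS.
have [/set_mem yi|_] := boolP (i + N \in y); last by lia.
by rewrite (mem_set (sub _ (leq_addl _ _) yi)); lia.
Qed.

(* If [y'] does not outgrow [y], then [y] and [y'] are eventually equal, hence
   so are the increments of their ranks. *)
Lemma staircase_total (y y' : set nat) H H' : doubling H -> doubling H' ->
  infinite_set y -> almost_subset y y' ->
  almost_subset (staircase y H) (staircase y' H') \/
  almost_subset (staircase y' H') (staircase y H).
Proof.
move=> dH dH' yinf /almost_subset_natP[N sub].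
have [[M NM lt]|nlt] := pselect (exists2 M, N <= M & rank y M < rank y' M).
  left; apply: (@staircase_rank_lt _ _ _ _ M) => // n Mn.
  exact/sub/(leq_trans NM).
have le n : N <= n -> rank y' n <= rank y n.
  by move=> Nn; rewrite leqNgt; apply/negP => lt; apply: nlt; exists n.
(* [M] minimizes the surplus of [rank y] over [rank y'] beyond [N]. A later point of [y'] outside
   [y] would lower it, so from [M] on the sets agree and the surplus is constant. *)
have [M NM minM] : exists2 M, N <= M & forall n, N <= n ->
    rank y M - rank y' M <= rank y n - rank y' n.
  have ex : exists d, `[< exists2 n, N <= n & d = rank y n - rank y' n >].
    by exists (rank y N - rank y' N); apply/asboolP; exists N.
  case: (ex_minnP ex) => d /asboolP[M NM ->] minM; exists M => // n Nn.
  by apply: minM; apply/asboolP; exists n.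
have step n : M <= n -> (n \in y') = (n \in y) /\
    rank y n + rank y' M = rank y' n + rank y M.
  move=> Mn; rewrite -(subnK Mn); elim: (n - M) => [|i [IHm IHr]].
    rewrite add0n; split; last by lia.
    have := minM _ (leqW NM); have := le _ (leqW NM); have := le _ NM.
    rewrite !rankS; case: (boolP (M \in y)) => [/set_mem/(sub _ NM)/mem_set ->//|_].
    by case: (M \in y') => //=; lia.
  have NiM : N <= i.+1 + M by lia.
  have eqr : rank y (i.+1 + M) + rank y' M = rank y' (i.+1 + M) + rank y M.
    by rewrite addSn !rankS IHm; lia.
  split=> //; have := minM _ (leqW NiM); have := le _ (leqW NiM).
  have := le _ NiM; have := le _ NM.
  rewrite !(rankS _ (i.+1 + M)).
  case: (boolP (i.+1 + M \in y)) => [/set_mem/(sub _ NiM)/mem_set ->//|_].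
  by case: (i.+1 + M \in y') => //=; lia.
have eqy n : M <= n -> y' n <-> y n.
  move=> /step[e _]; split=> [/mem_set|/mem_set]; first by rewrite e => /set_mem.
  by rewrite -e => /set_mem.
(* A positive surplus puts [y] ahead in rank, and the rank comparison applies with the roles
   exchanged. With no surplus the ranks agree and the heights decide. *)
have := le _ NM; rewrite leq_eqVlt => /orP[/eqP eM|lt]; last first.
  right; apply: (@staircase_rank_lt _ _ _ _ M) => // n Mn.
  by move/eqy; apply.
have eqr n : M <= n -> rank y' n = rank y n by move=> /step[_]; lia.
case: (doubling_total dH dH') => [[K HK]|[K HK]]; [left|right];
  have [L KL] := rank_unbounded K yinf;
  apply: (@staircase_almost_subset _ _ _ _ (maxn L M)) => // n;
  rewrite geq_max => /andP[Ln Mn] yn; (split; first exact/eqy);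
  rewrite eqr //; apply: HK; exact: leq_trans KL (leq_rank _ Ln).
Qed.

Lemma staircase_ilt (F : set (set nat)) (P : set (set nat * (nat -> nat))) :
  ilt F -> (forall y H, P (y, H) -> F y /\ doubling H) ->
  (forall y, F y -> exists H, P (y, H)) ->
  ilt [set z | exists y H, P (y, H) /\ z = staircase y H].
Proof.
move=> [Finf Flin Fmax] PF FP; split.
- move=> z [y [H [/PF[Fy dH] ->]]]; exact: infinite_staircase dH (Finf _ Fy).
- move=> _ _ [y [H [/PF[Fy dH] ->]]] [y' [H' [/PF[Fy' dH'] ->]]].
  case: (Flin _ _ Fy Fy') => [s|s].
    exact: staircase_total dH dH' (Finf _ Fy) s.
  by apply/or_comm; exact: staircase_total dH' dH (Finf _ Fy') s.
move=> [Z [Zinf ZG]]; apply: (Fmax).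
(* The candidate is the set of columns that [Z] meets. *)
exists [set n | exists m, Z (qpair n m)]; split; last first.
  move=> y Fy; have [H PyH] := FP _ Fy; have [_ dH] := PF _ _ PyH.
  have /almost_subset_natP[N ZN] : almost_subset Z (staircase y H).
    by apply: ZG; exists y, H.
  apply/almost_subset_natP; exists N => n Nn [m Zm].
  have /staircaseE[]// : staircase y H (qpair n m).
  exact: ZN (leq_trans Nn (qpair_gel _ _)) Zm.
(* A member of [F] is needed to bound the columns of [Z]; were [F] empty, [setT] would be a
   pseudointersection. *)
have [y Fy] : exists y, F y.
  apply: contrapT => nF; apply: Fmax; exists setT; split.
    exact: infinite_nat.
  by move=> y Fy; case: nF; exists y.
have [H PyH] := FP _ Fy; have [_ dH] := PF _ _ PyH.
have /almost_subset_natP[N ZN] : almost_subset Z (staircase y H).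
  by apply: ZG; exists y, H.
apply/infinite_set_natP => M.
(* Past this bound a point of the staircase cannot lie in a column before [M]. *)
move/infinite_set_natP : Zinf => /(_ (maxn N (qpair M (H (rank y M))))).
move=> [i]; rewrite geq_max => /andP[Ni Mi] Zi.
have zi := ZN _ Ni Zi; have [n [m [ei _ _]]] := zi.
exists n; last by exists m; rewrite -ei.
rewrite leqNgt; apply/negP => nM; move: Mi.
by rewrite leqNgt ei (staircase_column_bound dH nM) // -ei.
Qed.

(** * Coding a real in the digits of a height function *)

Definition odd_step (H : nat -> nat) (k : nat) : Prop :=
  H k.+1 = (H k + H k).+1.

(* Taking the least [v] makes [w] a function of [H] whatever the digits of
   [H] are. *)
Definition reads (H w : nat -> nat) : Prop :=
  forall i, odd_step H (qpair i (w i)) /\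
    forall v, ~ v < w i \/ ~ odd_step H (qpair i v).

Definition readable (H : nat -> nat) : Prop :=
  forall i, exists v, odd_step H (qpair i v).

(** The digits of [H] are the characteristic function of the graph of [w], transported along
    [qpair]. *)
Lemma exists_reads (w : nat -> nat) : exists2 H, doubling H & reads H w.
Proof.
pose b k := nat_of_bool `[< exists i, k = qpair i (w i) >].
pose H := nat_rect (fun=> nat) 1 (fun k h => h + h + b k).
have HS k : H k.+1 = H k + H k + b k by [].
have bE i v : b (qpair i v) = (v == w i).
  congr nat_of_bool; apply/asboolP/eqP => [[j /qpair_inj[-> ->]]//|->].
  by exists i.
exists H.
  by split=> // k; rewrite HS /b; case: asbool => /=; lia.
move=> i; split=> [|v]; rewrite /odd_step HS bE ?eqxx; first by rewrite addn1.
by case: (ltnP v (w i)) => lt; [right; rewrite (ltn_eqF lt) | left]; lia.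
Qed.

Lemma readable_reads H : readable H -> exists w, reads H w.
Proof.
move=> rH; suff /choice[w ww] : forall i, exists wi,
    odd_step H (qpair i wi) /\ forall v, ~ v < wi \/ ~ odd_step H (qpair i v).
  by exists w.
move=> i.
have ex : exists v, `[< odd_step H (qpair i v) >].
  by have [v ?] := rH i; exists v; apply/asboolP.
case: (ex_minnP ex) => wi /asboolP owi minw; exists wi; split=> // v.
have [lt|le] := ltnP v wi; last by left.
by right => /asboolP/minw; rewrite leqNgt lt.
Qed.

Lemma reads_unique H w w' : reads H w -> reads H w' -> w = w'.
Proof.
move=> r r'; apply/funext => i; have [o m] := r i; have [o' m'] := r' i.
case: (ltngtP (w i) (w' i)) => // lt.
  by case: (m' (w i)).
by case: (m (w' i)).
Qed.

(** * Substitution for function variables *)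

Fixpoint subst_term (s : nat -> term -> term) (t : term) : term :=
  match t with
  | TVar i => TVar i
  | TZero => TZero
  | TSucc t => TSucc (subst_term s t)
  | TAdd t u => TAdd (subst_term s t) (subst_term s u)
  | TMul t u => TMul (subst_term s t) (subst_term s u)
  | TApp i t => s i (subst_term s t)
  end.

(* Only meaningful on arithmetical formulas: the environment shift under a
   function quantifier is not implemented. *)
Fixpoint subst_formula (s : nat -> term -> term) (p : formula) : formula :=
  match p with
  | FEq t u => FEq (subst_term s t) (subst_term s u)
  | FLt t u => FLt (subst_term s t) (subst_term s u)
  | FNot p => FNot (subst_formula s p)
  | FAnd p q => FAnd (subst_formula s p) (subst_formula s q)
  | FOr p q => FOr (subst_formula s p) (subst_formula s q)
  | FAll0 p => FAll0 (subst_formula s p)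
  | FEx0 p => FEx0 (subst_formula s p)
  | FAll1 p => FAll1 p
  | FEx1 p => FEx1 p
  end.

Lemma arithmetical_subst s p : arithmetical (subst_formula s p) = arithmetical p.
Proof. by elim: p => //= p -> q ->. Qed.

(** The hypothesis on [s] is uniform in the number environment, so it survives number
    quantifiers. *)
Lemma sat_subst s e1 e1' p e0 :
    (forall i t e, eval e e1' (s i t) = e1 i (eval e e1' t)) ->
  arithmetical p -> sat e0 e1' (subst_formula s p) = sat e0 e1 p.
Proof.
move=> es.
have et t e : eval e e1' (subst_term s t) = eval e e1 t.
  elim: t => //= [t ->|t -> u ->|t -> u ->|i t <-] //.
elim: p e0 => //=.
- by move=> t u e0 _; rewrite !et.
- by move=> t u e0 _; rewrite !et.
- by move=> p IH e0 ap; rewrite IH.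
- by move=> p IHp q IHq e0 /andP[ap aq]; rewrite IHp ?IHq.
- by move=> p IHp q IHq e0 /andP[ap aq]; rewrite IHp ?IHq.
- by move=> p IH e0 ap; under eq_forall => n do rewrite IH//.
- by move=> p IH e0 ap; under eq_exists => n do rewrite IH//.
Qed.

(** * Ingredients of the defining formula *)

Definition FImp (p q : formula) : formula := FOr (FNot p) q.

Lemma sat_imp e0 e1 p q : sat e0 e1 (FImp p q) = (sat e0 e1 p -> sat e0 e1 q).
Proof. by rewrite /= implyE. Qed.

Definition numeral (n : nat) : term := iter n TSucc TZero.

(** A [Pi1_formula 1] has a single leading function quantifier, so four functions are interleaved
    modulo 4. *)
Definition column_term (j : nat) (t : term) : term :=
  TApp 0 (TAdd (TMul (numeral 4) t) (numeral j)).

Definition column (f : nat -> nat) (j n : nat) : nat := f (4 * n + j).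

Definition merge (f : seq (nat -> nat)) (i : nat) : nat :=
  nth (@id nat) f (i %% 4) (i %/ 4).

Lemma column_merge f j : j < 4 -> column (merge f) j = nth (@id nat) f j.
Proof.
move=> j4; apply/funext => n; rewrite /column /merge mulnC.
by rewrite modnMDl divnMDl// modn_small// divn_small// addn0.
Qed.

Definition pair_term (t u : term) : term :=
  TAdd (TMul (TAdd t u) (TAdd t u)) t.

Definition indicator (A : set nat) (n : nat) : nat := nat_of_bool (n \in A).

Lemma indicator_eq1 A n : (indicator A n = 1) = A n.
Proof.
rewrite /indicator propeqE; split=> [|/mem_set->//].
by case: (boolP (n \in A)) => // /set_mem.
Qed.

Lemma indicator_eq0 A n : (indicator A n = 0) = ~ A n.
Proof.
rewrite /indicator propeqE; case: (boolP (n \in A)) => [/set_mem|] An.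
  by split.
by split=> // _ /mem_set; apply/negP.
Qed.

Definition support (A : set nat) : set nat := [set n | A (qpair n 0)].

Lemma indicator_support A n : indicator (support A) n = indicator A (qpair n 0).
Proof. by rewrite /indicator; congr nat_of_bool; apply/idP/idP; rewrite !inE. Qed.

(** The recursion has a unique solution, so a formula with number quantifiers only can identify [c]
    as the rank function. *)
Lemma rank_support A c :
  (c 0 = 0 /\ forall n, c n.+1 = c n + indicator A (qpair n 0)) =
  (c = rank (support A)).
Proof.
rewrite propeqE; split=> [[c0 cS]|->].
  by apply/funext; elim=> [|n IH]; rewrite ?rank0 // cS IH rankS -indicator_support.
by rewrite rank0; split=> // n; rewrite rankS -indicator_support.
Qed.

(** The first clause excludes numbers outside the range of [qpair]; by the second, a nonempty column
    contains its bottom point, so [support] detects it. *)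
Definition finite_columns (A : set nat) : Prop :=
  (forall i, A i -> exists n m, i = qpair n m) /\
  forall n, exists h, forall m, A (qpair n m) <-> m < h.

Definition column_heights (A : set nat) (c H : nat -> nat) : Prop :=
  forall n, support A n -> forall m, A (qpair n m) <-> m < H (c n).

(* The matrix of the Pi11 definition lives in an environment where function
   variable 0 merges four functions: column 0 is the universally quantified
   function of the given Sigma12 definition, column 1 its witness [w], column 2
   the rank function and column 3 the height function. Function variable 1 is
   the indicator of the defined set. *)
Section Formulas.
Let V := TVar.
Let W := column_term 1.
Let C := column_term 2.
Let H := column_term 3.
Let Z := TApp 1.

Definition agree_formula (t u v : term) : formula :=
  FOr (FAnd (FEq (Z t) (numeral 1)) (FLt u v))
      (FAnd (FEq (Z t) TZero) (FNot (FLt u v))).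

Definition finite_columns_formula : formula :=
  FAnd (FAll0 (FOr (FEq (Z (V 0)) TZero)
                   (FEx0 (FEx0 (FEq (V 2) (pair_term (V 1) (V 0)))))))
       (FAll0 (FEx0 (FAll0
         (agree_formula (pair_term (V 2) (V 0)) (V 0) (V 1))))).

Definition rank_formula : formula :=
  FAnd (FEq (C TZero) TZero)
       (FAll0 (FEq (C (TSucc (V 0)))
                   (TAdd (C (V 0)) (Z (pair_term (V 0) TZero))))).

Definition column_heights_formula : formula :=
  FAll0 (FOr (FEq (Z (pair_term (V 0) TZero)) TZero)
             (FAll0 (agree_formula (pair_term (V 1) (V 0)) (V 0) (H (C (V 1)))))).

Definition odd_step_formula (t : term) : formula :=
  FEq (H (TSucc t)) (TSucc (TAdd (H t) (H t))).

Definition doubling_formula : formula :=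
  FAnd (FEq (H TZero) (numeral 1))
       (FAll0 (FOr (FEq (H (TSucc (V 0))) (TAdd (H (V 0)) (H (V 0))))
                   (odd_step_formula (V 0)))).

Definition readable_formula : formula :=
  FAll0 (FEx0 (odd_step_formula (pair_term (V 1) (V 0)))).

Definition reads_formula : formula :=
  FAll0 (FAnd (odd_step_formula (pair_term (V 0) (W (V 0))))
              (FAll0 (FOr (FNot (FLt (V 0) (W (V 1))))
                          (FNot (odd_step_formula (pair_term (V 1) (V 0))))))).

(** The given matrix sees the quantified function, the witness, the indicator of [y], then the
    parameters. Here [y] is read off the bottom row of the defined set, and parameter indices drop
    by one. *)
Definition decode_term (i : nat) (t : term) : term :=
  match i with
  | 0 => column_term 0 t
  | 1 => column_term 1 t
  | 2 => TApp 1 (pair_term t TZero)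
  | j.+3 => TApp j.+2 t
  end.

(** Each premise determines its function uniquely, so the universal form can replace an existential
    one. [finite_columns_formula] and [readable_formula] are asserted outright: they guarantee that
    heights and a witness exist, which keeps the implications from being vacuous. *)
Definition tower_matrix (p : formula) : formula :=
  FAnd finite_columns_formula
    (FImp rank_formula (FImp column_heights_formula
      (FAnd (FAnd doubling_formula readable_formula)
        (FImp reads_formula (subst_formula decode_term p))))).
End Formulas.

(** * Meaning of the formulas *)

Section Semantics.
Variables (e0 f : nat -> nat) (A : set nat) (e : nat -> nat -> nat).
Let e1 := scons f (scons (indicator A) e).

Lemma sat_agree e0' t u v :
  sat e0' e1 (agree_formula t u v) =
  (A (eval e0' e1 t) <-> eval e0' e1 u < eval e0' e1 v).
Proof.
rewrite /= indicator_eq1 indicator_eq0 propeqE.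
by case: (_ < _); case: (pselect (A (eval e0' e1 t))); tauto.
Qed.

Lemma sat_finite_columns : sat e0 e1 finite_columns_formula = finite_columns A.
Proof.
congr and.
  by apply: eq_forall => i; rewrite implyE -indicator_eq0.
apply: eq_forall => n; apply: eq_exists => h; apply: eq_forall => m.
exact: sat_agree.
Qed.

Lemma sat_rank : sat e0 e1 rank_formula = (column f 2 = rank (support A)).
Proof. exact: rank_support. Qed.

Lemma sat_column_heights :
  sat e0 e1 column_heights_formula =
  column_heights A (column f 2) (column f 3).
Proof.
apply: eq_forall => n; rewrite implyE -indicator_eq0; congr or.
by apply: eq_forall => m; exact: sat_agree.
Qed.

(** This and the next two hold by computation, because the predicates are written with the same
    connectives as their formulas. *)
Lemma sat_doubling : sat e0 e1 doubling_formula = doubling (column f 3).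
Proof. by []. Qed.

Lemma sat_readable : sat e0 e1 readable_formula = readable (column f 3).
Proof. by []. Qed.

Lemma sat_reads : sat e0 e1 reads_formula = reads (column f 3) (column f 1).
Proof. by []. Qed.

Lemma sat_decode p : arithmetical p ->
  sat e0 e1 (subst_formula decode_term p) =
  sat e0 (scons (column f 0) (scons (column f 1)
    (scons (indicator (support A)) e))) p.
Proof.
apply: sat_subst => -[|[|[|i]]] t e0' //=.
Qed.
End Semantics.

Lemma sat_tower p e0 (A : set nat) e : arithmetical p ->
  sat e0 (scons (indicator A) e) (FAll1 (tower_matrix p)) <->
  forall g w c H : nat -> nat, finite_columns A /\
    (c = rank (support A) -> column_heights A c H ->
     (doubling H /\ readable H) /\
     (reads H w ->
      sat e0 (scons g (scons w (scons (indicator (support A)) e))) p)).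
Proof.
move=> ap.
have satE f : sat e0 (scons f (scons (indicator A) e)) (tower_matrix p) =
    (finite_columns A /\
     (column f 2 = rank (support A) ->
      column_heights A (column f 2) (column f 3) ->
      (doubling (column f 3) /\ readable (column f 3)) /\
      (reads (column f 3) (column f 1) ->
       sat e0 (scons (column f 0) (scons (column f 1)
         (scons (indicator (support A)) e))) p))).
  have satA q r e0' e1' : sat e0' e1' (FAnd q r) = (sat e0' e1' q /\ sat e0' e1' r) by [].
  rewrite /tower_matrix satA sat_finite_columns !sat_imp sat_rank.
  rewrite sat_column_heights.
  by rewrite 2!satA sat_doubling sat_readable sat_imp sat_reads sat_decode.
split=> [sf g w c H|sf f].
  have : sat e0 (scons (merge [:: g; w; c; H]) (scons (indicator A) e))
    (tower_matrix p) by exact: sf.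
  by rewrite satE !column_merge.
suff : sat e0 (scons f (scons (indicator A) e)) (tower_matrix p) by [].
by rewrite satE; exact: sf.
Qed.

(** * Decoding a staircase *)

Lemma support_staircase y H : doubling H -> support (staircase y H) = y.
Proof. by move=> dH; apply/seteqP; split=> n /(staircase0 _ _ dH). Qed.

Lemma finite_columns_staircase y H : finite_columns (staircase y H).
Proof.
split=> [i [n [m [-> _ _]]]|n]; first by exists n, m.
have [yn|yn] := pselect (y n); [exists (H (rank y n)) | exists 0] => m;
  by rewrite staircaseE; split=> // -[].
Qed.

(** Every index is the rank of some point because [y] is infinite, so the columns fix all values of
    [H']. *)
Lemma column_heights_staircase y H H' : doubling H -> infinite_set y ->
  column_heights (staircase y H) (rank y) H' <-> H' = H.
Proof.
move=> dH yinf; split=> [hts|-> n]; last first.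
  rewrite support_staircase // => yn m; rewrite staircaseE.
  by split=> [[]//|].
apply/funext => k; have [n yn <-] := rank_surj k yinf.
have lt m : m < H (rank y n) <-> m < H' (rank y n).
  have yn' : support (staircase y H) n by rewrite support_staircase.
  by rewrite -(hts n yn' m) staircaseE; split=> [|[]].
apply/eqP; rewrite eqn_leq; apply/andP; split; rewrite leqNgt; apply/negP.
  by move/lt; rewrite ltnn.
by move/lt; rewrite ltnn.
Qed.

(** At most one point of the support has a given rank, so no two columns compete for a value; ranks
    not attained get 0. *)
Lemma exists_column_heights A : finite_columns A ->
  exists H, column_heights A (rank (support A)) H.
Proof.
move=> [_ cols].
suff /choice[H HA] : forall k, exists h, forall n, support A n ->
    rank (support A) n = k -> forall m, A (qpair n m) <-> m < h.
  by exists H => n An; exact: HA.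
move=> k.
have [[n [An nk]]|nex] :=
  pselect (exists n, support A n /\ rank (support A) n = k); last first.
  by exists 0 => n An nk; case: nex; exists n.
have [h hn] := cols n; exists h => n' An' n'k.
by rewrite (@rank_inj (support A) n' n) // n'k.
Qed.

Lemma staircase_column_heights A H : finite_columns A ->
  column_heights A (rank (support A)) H -> A = staircase (support A) H.
Proof.
move=> [dom cols] hts; apply/seteqP; split=> [i Ai|_ [n [m [-> An lt]]]].
  have [n [m ei]] := dom i Ai; have [h hn] := cols n.
  rewrite ei in Ai *; have An : support A n.
    by apply/hn/(leq_ltn_trans (leq0n m)); exact/hn.
  by apply/staircaseE; split=> //; exact/(hts n An).
exact/(hts n An).
Qed.

Lemma sat_towerP p e0 e (A : set nat) : arithmetical p ->
    (forall y w, (forall g, sat e0 (scons g (scons w (scons (indicator y) e))) p) ->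
      infinite_set y) ->
  sat e0 (scons (indicator A) e) (FAll1 (tower_matrix p)) <->
  exists y H, [/\ doubling H, exists2 w, reads H w &
      forall g, sat e0 (scons g (scons w (scons (indicator y) e))) p
    & A = staircase y H].
Proof.
move=> ap yinf; rewrite sat_tower //; split.
  move=> sA.
  have [fA _] := sA id id id id.
  have [H hts] := exists_column_heights fA.
  have [_ /(_ erefl hts)[[dH rH] _]] := sA id id (rank (support A)) H.
  have [w rw] := readable_reads rH.
  exists (support A), H; split=> //; last exact: staircase_column_heights.
  exists w => // g.
  by have [_ /(_ erefl hts)[_]] := sA g w (rank (support A)) H; apply.
(* For the converse, any [c], [H'] and [w'] meeting the premises coincide with the actual rank
   function, [H] and [w]. *)
move=> [y [H [dH [w rw sw] ->]]] g w' c H'.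
rewrite support_staircase //; split; first exact: finite_columns_staircase.
move=> -> /(column_heights_staircase _ dH (yinf _ _ sw)) ->; split.
  by split=> // i; exists (w i); have [] := rw i.
by move=> /(reads_unique rw) <-.
Qed.

Theorem theorem7p2 (x : nat -> nat) :
  (exists F : set (set nat), Sigma1 2 x F /\ ilt F) ->
  exists G : set (set nat), Pi1 1 x G /\ ilt G.
Proof.
move=> [F [[p + defF] iltF]].
(* Only the shape [FEx1 (FAll1 p)] with [p] arithmetical passes the class check. *)
case: p defF => // -[]// p defF; rewrite /= => ap.
pose e := scons x (fun _ _ : nat => 0).
have FP y : F y <-> exists w, forall g,
    sat (fun=> 0) (scons g (scons w (scons (indicator y) e))) p.
  by rewrite defF.
pose P : set (set nat * (nat -> nat)) := [set yH | doubling yH.2 /\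
  exists2 w, reads yH.2 w &
    forall g, sat (fun=> 0) (scons g (scons w (scons (indicator yH.1) e))) p].
exists [set z | exists y H, P (y, H) /\ z = staircase y H]; split.
  exists (FAll1 (tower_matrix p)).
    by rewrite /= arithmetical_subst ap.
  have [Finf _ _] := iltF.
  apply/seteqP; split=> A.
    move=> [y [H [[dH wH] ->]]]; apply/sat_towerP => //.
      by move=> y' w sw; apply/Finf/FP; exists w.
    by exists y, H.
  move=> /sat_towerP[//||y [H [dH wH ->]]].
    by move=> y' w sw; apply/Finf/FP; exists w.
  by exists y, H.
apply: staircase_ilt iltF _ _ => [y H [dH [w _ sw]]|y /FP[w sw]].
  by split=> //; apply/FP; exists w.
have [H dH rw] := exists_reads w.
by exists H; split=> //; exists w.
Qed.
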